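(* Let $H$ be a graph that contains a cycle and has no vertex of degree greater than $3$. Then there is no function $f$ with $f(k)=o(k\log k)$ such that the class of $H$-subdivisions has the induced Erdős–Pósa property with bounding function $f$; that is, for every such $f$ there is a graph $G$ with $\tau_H(G)> f(\nu_H(G))$.
   Context: All graphs are finite and simple. A subdivision of $H$ is a graph obtained from $H$ by repeatedly replacing an edge by a path of length $2$ through a new vertex. An induced subdivision of $H$ in $G$ is an induced subgraph of $G$ isomorphic to a subdivision of $H$. $\nu_H(G)$ is the maximum number of pairwise vertex-disjoint induced subdivisions of $H$ in $G$, and $\tau_H(G)$ the minimum size of $X\subseteq V(G)$ such that $G-X$ has no induced subdivision of $H$. A function $f$ is a bounding function for the induced Erdős–Pósa property of $H$-subdivisions if $\tau_H(G)\le f(\nu_H(G))$ for every graph $G$. *)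

(* Defs.v *)
From mathcomp Require Import all_boot.
From Stdlib Require Import Reals.
Set Implicit Arguments. Unset Strict Implicit. Unset Printing Implicit Defensive.

Definition simple_graph (T : finType) (e : rel T) : Prop :=
  symmetric e /\ irreflexive e.

Definition graph_iso (T S : finType) (e : rel T) (f : rel S) : Prop :=
  exists g : T -> S, bijective g /\ forall a b, f (g a) (g b) = e a b.

(* The graph on option T obtained from (T,e) by replacing the edge xy with a
   path x - None - y through the new vertex None. *)
Definition subdiv_rel (T : finType) (e : rel T) (x y : T) : rel (option T) :=
  fun a b =>
    match a, b with
    | Some a, Some b => e a b && ~~ (((a == x) && (b == y)) || ((a == y) && (b == x)))
    | None, Some b | Some b, None => (b == x) || (b == y)
    | None, None => false
    end.

Definition subdiv_step (T : finType) (e : rel T) (S : finType) (f : rel S) : Prop :=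
  exists x y : T, e x y /\ graph_iso (subdiv_rel e x y) f.

Inductive subdivision (T : finType) (e : rel T) : forall (S : finType), rel S -> Prop :=
| subdiv_base (S : finType) (f : rel S) : graph_iso e f -> subdivision e f
| subdiv_more (S : finType) (f : rel S) (U : finType) (h : rel U) :
    subdivision e f -> subdiv_step f h -> subdivision e h.

Definition induced_subdiv (TH : finType) (eH : rel TH) (T : finType) (e : rel T)
    (A : {set T}) : Prop :=
  exists (U : finType) (h : rel U) (g : U -> T),
    subdivision eH h /\ injective g /\ g @: setT = A /\
    forall a b, e (g a) (g b) = h a b.

Definition is_nu (TH : finType) (eH : rel TH) (T : finType) (e : rel T) (k : nat) : Prop :=
  (exists P : {set {set T}},
      (forall A, A \in P -> induced_subdiv eH e A) /\ trivIset P /\ #|P| = k) /\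
  (forall P : {set {set T}},
      (forall A, A \in P -> induced_subdiv eH e A) -> trivIset P -> #|P| <= k).

Definition hits_all (TH : finType) (eH : rel TH) (T : finType) (e : rel T) (X : {set T}) : Prop :=
  forall A : {set T}, induced_subdiv eH e A -> ~~ [disjoint A & X].

Definition is_tau (TH : finType) (eH : rel TH) (T : finType) (e : rel T) (t : nat) : Prop :=
  (exists X : {set T}, hits_all eH e X /\ #|X| = t) /\
  (forall X : {set T}, hits_all eH e X -> t <= #|X|).

Definition has_cycle (T : finType) (e : rel T) : Prop :=
  exists s : seq T, 3 <= size s /\ uniq s /\ cycle e s.

Definition max_deg_le3 (T : finType) (e : rel T) : Prop :=
  forall v : T, #|[set u | e v u]| <= 3.

Definition little_o_klogk (f : nat -> R) : Prop :=
  forall eps : R, Rlt 0%R eps -> exists K : nat, forall k : nat, K <= k ->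
    Rle (Rabs (f k)) (Rmult (Rmult eps (INR k)) (ln (INR k))).

(* Main.v *)
From Stdlib Require Import Reals Lra Classical.
From mathcomp Require Import all_boot zify.
Require Import Defs.
Set Implicit Arguments. Unset Strict Implicit. Unset Printing Implicit Defensive.

(** Fix [D] such that every graph of average degree at least [D] contains a subdivision of [H] as a
    subgraph (Mader). The Erdos-Sachs greedy construction gives a graph [G] on [n] vertices with
    maximum degree at most [Delta = 4 D], average degree at least [Delta / 2] and girth at least
    [g], where [n = 2 (Delta + 1) ^ g]. Deleting [n / 8] vertices leaves average degree at least
    [D], so a subdivision of [H] survives; subdividing every edge of [G] once turns subgraphs into
    induced subgraphs, hence [tau > n / 8]. Every subdivision of [H] contains a cycle, so it has at
    least [g] vertices and [nu <= (Delta + 1) n / g]. Since [g] is of order [log n], [tau] is of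
    order [nu log nu].

    Girth is measured by nonempty vertex sets of minimum degree at least two ([two_core]) rather
    than by cycles: such sets are easily transported along subdivisions. *)

(** * Subdivisions *)

Definition add_edge (T : finType) (e : rel T) (u v : T) : rel T :=
  fun a b => [|| e a b, (a == u) && (b == v) | (a == v) && (b == u)].

Lemma graph_iso_refl (T : finType) (e : rel T) : graph_iso e e.
Proof. by exists id; split=> //; exists id. Qed.

Lemma graph_iso_eq (T S : finType) (e e' : rel T) (f : rel S) :
  e =2 e' -> graph_iso e f -> graph_iso e' f.
Proof. by move=> ee' [g [bg ge]]; exists g; split=> // a b; rewrite ge ee'. Qed.

Lemma subdivision_eq (T S : finType) (e e' : rel T) (f : rel S) :
  e =2 e' -> subdivision e f -> subdivision e' f.
Proof.
move=> ee'; elim=> {S f} [S f|S f U h _ IH st].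
  by move/(graph_iso_eq ee'); apply: subdiv_base.
exact: subdiv_more IH st.
Qed.

Lemma subdivision_subdiv_rel (T S : finType) (e : rel T) (f : rel S) x y :
  subdivision e f -> f x y -> subdivision e (subdiv_rel f x y).
Proof.
by move=> ef fxy; apply: subdiv_more ef _; exists x, y; split=> //; apply: graph_iso_refl.
Qed.

Lemma simple_graph_iso (T S : finType) (e : rel T) (f : rel S) :
  simple_graph e -> graph_iso e f -> simple_graph f.
Proof.
move=> [se ie] [g [[k gK kK] ge]]; split=> [a b|a]; rewrite -(kK a) ?ge ?ie //.
by rewrite -(kK b) !ge se.
Qed.

Lemma simple_subdiv_rel (T : finType) (e : rel T) x y :
  simple_graph e -> simple_graph (subdiv_rel e x y).
Proof.
move=> [se ie]; split=> [[a|] [b|] //=|[a|] //=]; last by rewrite ie.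
by rewrite se orbC ![_ && (b == _)]andbC.
Qed.

Lemma simple_subdivision (T S : finType) (e : rel T) (f : rel S) :
  simple_graph e -> subdivision e f -> simple_graph f.
Proof.
move=> se; elim=> {S f} [S f|S f U h _ IH [x [y [_ i]]]]; first exact: simple_graph_iso.
by apply: simple_graph_iso i; apply: simple_subdiv_rel.
Qed.

Lemma subdivision_card (T S : finType) (e : rel T) (f : rel S) :
  subdivision e f -> #|T| <= #|S|.
Proof.
elim=> {S f} [S f [g [bg _]]|S f U h _ IH [x [y [_ [g [bg _]]]]]].
  by rewrite (bij_eq_card bg).
by apply: leq_trans IH _; rewrite -(bij_eq_card bg) card_option.
Qed.

(** Adding a missing edge commutes with subdividing: [x] and [y] survive every step as old vertices,
    and a step never joins two old vertices. This supports the induction on the edges of $H$. *)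
Lemma subdivision_add_edge (T S : finType) (e : rel T) (f : rel S) x y :
  subdivision e f -> x != y -> ~~ e x y -> ~~ e y x ->
  exists u v, [/\ u != v, ~~ f u v, ~~ f v u &
    subdivision (add_edge e x y) (add_edge f u v)].
Proof.
move=> ef xy exy eyx; elim: ef => {S f} [S f [g [bg ge]]|S f U h _ IH st].
  have ig := bij_inj bg.
  exists (g x), (g y); rewrite (inj_eq ig) !ge; split=> //.
  apply: subdiv_base; exists g; split=> // a b.
  by rewrite /add_edge ge !(inj_eq ig).
have [u [v [uv fuv fvu sub]]] := IH.
have [p [q [fpq [g [bg ge]]]]] := st.
have ig := bij_inj bg.
exists (g (Some u)), (g (Some v)); rewrite !ge /= (negbTE fuv) (negbTE fvu).
rewrite (inj_eq ig) (inj_eq (@Some_inj _)); split=> //.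
apply: subdiv_more sub _; exists p, q; split; first by rewrite /add_edge fpq.
exists g; split=> // a b; rewrite /add_edge ge !(inj_eq ig).
case: a b => [a|] [b|] //=; rewrite ?(inj_eq (@Some_inj _)) ?andbF ?orbF //.
(* The new pair is never the subdivided one: [f p q] holds, while [f u v] and [f v u] fail. *)
have [/andP[/eqP-> /eqP->]|_] := boolP ((a == u) && (b == v)).
  rewrite !orbT /=; apply/esym/negP => /orP[]/andP[/eqP E1 /eqP E2].
    by case/negP: fuv; rewrite E1 E2.
  by case/negP: fvu; rewrite E1 E2.
have [/andP[/eqP-> /eqP->]|_] := boolP ((a == v) && (b == u)); last by rewrite !orbF.
rewrite !orbT /=; apply/esym/negP => /orP[]/andP[/eqP E1 /eqP E2].
  by case/negP: fvu; rewrite E1 E2.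
by case/negP: fuv; rewrite E1 E2.
Qed.

(** * Two-cores *)

Definition deg (T : finType) (e : rel T) (W : {set T}) (v : T) : nat :=
  #|[set u in W | e v u]|.

Definition two_core (T : finType) (e : rel T) (C : {set T}) : Prop :=
  C != set0 /\ forall x, x \in C -> 1 < deg e C x.

Lemma two_core_of_cycle (T : finType) (e : rel T) :
  symmetric e -> has_cycle e -> exists C, two_core e C.
Proof.
move=> se [s [s3 [us cs]]]; exists [set x in s]; split.
  by case: s s3 {us cs} => // x s _; apply/set0Pn; exists x; rewrite !inE eqxx.
move=> x; rewrite inE => xs.
(* After rotating the cycle to start at [x], the two neighbours of [x] are its second and last
   entries. *)
have [i s' Es] := rot_to xs.
have us' : uniq (x :: s') by rewrite -Es rot_uniq.
have cs' : cycle e (x :: s') by rewrite -Es rot_cycle.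
have sz : 2 < size (x :: s') by rewrite -Es size_rot.
have ms : s =i x :: s' by move=> z; rewrite -Es mem_rot.
case: s' {Es} us' cs' sz ms => [|y s'] //; case/lastP: s' => [|s' z] //.
move=> us' cs' _ ms.
have yz : y != z by move: us' => /= /and3P[_]; rewrite mem_rcons inE negb_or => /andP[].
have exy : e x y by case/andP: cs'.
have exz : e x z.
  by move: cs'; rewrite /= !rcons_path last_rcons => /and3P[_ _]; rewrite se.
have <- : #|[set y; z]| = 2 by rewrite cards2 yz.
apply/subset_leq_card/subsetP => t; rewrite !inE => /orP[]/eqP->; rewrite ms ?exy ?exz andbT.
  by rewrite !inE eqxx orbT.
by rewrite !inE mem_rcons inE eqxx !orbT.
Qed.

Lemma two_core_emb (T S : finType) (e : rel T) (f : rel S) (g : T -> S) C :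
  injective g -> (forall a b, e a b -> f (g a) (g b)) ->
  two_core e C -> two_core f (g @: C).
Proof.
move=> ig ge [C0 C2]; split.
  by apply: contra C0; rewrite imset_eq0.
move=> _ /imsetP[x xC ->]; apply: leq_trans (C2 _ xC) _.
rewrite /deg -(card_imset _ ig); apply/subset_leq_card/subsetP => _ /imsetP[y + ->].
by rewrite !inE => /andP[yC exy]; rewrite imset_f //=; apply: ge.
Qed.

Lemma two_core_subdiv_rel (T : finType) (e : rel T) x y C :
  simple_graph e -> e x y -> two_core e C -> exists C', two_core (subdiv_rel e x y) C'.
Proof.
move=> [se ie] exy [C0 C2].
have xy : x != y by apply: contraTneq exy => ->; rewrite ie.
have CS : Some @: C != set0 by rewrite imset_eq0.
have [/andP[xC yC]|nC] := boolP ((x \in C) && (y \in C)); last first.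
  exists (Some @: C); split=> // _ /imsetP[z zC ->].
  apply: leq_trans (C2 _ zC) _.
  rewrite /deg -(card_imset _ (@Some_inj _)).
  apply/subset_leq_card/subsetP => _ /imsetP[t + ->].
  rewrite !inE => /andP[tC ezt]; rewrite imset_f //= ezt /=.
  apply: contra nC => /orP[]/andP[/eqP<- /eqP<-]; rewrite zC tC //.
exists (None |: Some @: C); split; first by apply/set0Pn; exists None; rewrite !inE.
move=> z; rewrite !inE => /orP[/eqP->|/imsetP[{}z zC ->]].
  have <- : #|[set Some x; Some y]| = 2 by rewrite cards2 (inj_eq (@Some_inj _)) xy.
  apply/subset_leq_card/subsetP => t; rewrite !inE => /orP[]/eqP->.
    by rewrite imset_f //= eqxx.
  by rewrite imset_f //= eqxx orbT.
apply: leq_trans (C2 _ zC) _.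
(* [k] injects the old neighbourhood of [z] into the new one, trading a neighbour lost by the
   subdivision for the new vertex. *)
pose k t := if ((z == x) && (t == y)) || ((z == y) && (t == x)) then None else Some t.
have ik : injective k.
  move=> a b; rewrite /k; do 2![case: ifP => //].
    move=> /orP[]/andP[/eqP-> /eqP->] /orP[]/andP[/eqP E /eqP->] //; by rewrite E eqxx in xy.
  by move=> _ _ [].
rewrite /deg -(card_imset _ ik); apply/subset_leq_card/subsetP => _ /imsetP[t + ->].
rewrite !inE => /andP[tC ezt]; rewrite /k; case: ifP => [/orP[]/andP[/eqP-> _]|nzt] /=.
- by rewrite eqxx.
- by rewrite eqxx orbT.
by rewrite imset_f //= ezt nzt.
Qed.

Lemma two_core_subdivision (T S : finType) (e : rel T) (f : rel S) :
  simple_graph e -> (exists C, two_core e C) -> subdivision e f -> exists C, two_core f C.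
Proof.
move=> se [C0 c0]; elim=> {S f} [S f [g [bg ge]]|S f U h ef [C cC] [x [y [fxy [g [bg ge]]]]]].
  by exists (g @: C0); apply: two_core_emb c0 => //; [apply: bij_inj|move=> a b; rewrite ge].
have [C' c'] := two_core_subdiv_rel (simple_subdivision se ef) fxy cC.
by exists (g @: C'); apply: two_core_emb c' => //; [apply: bij_inj|move=> a b; rewrite ge].
Qed.

(* Peeling off the exceptional vertex [x] makes its only neighbour the next exceptional vertex. *)
Lemma two_core_pendant (T : finType) (e : rel T) (C : {set T}) x :
  simple_graph e -> x \in C -> 0 < deg e C x ->
  (forall z, z \in C -> z != x -> 1 < deg e C z) ->
  exists2 D : {set T}, D \subset C & two_core e D.
Proof.
move=> [se ie]; have [m] := ubnP #|C|; elim: m C x => // m IH C x Cm xC dx dz.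
have [dx2|dx1] := ltnP 1 (deg e C x).
  exists C => //; split; first by apply/set0Pn; exists x.
  by move=> z zC; have [->|zx] := eqVneq z x; last exact: dz.
have /card_gt0P[y] := dx; rewrite !inE => /andP[yC exy].
have Nx z : z \in C -> e x z -> z = y.
  move=> zC exz; have /card_le1_eqP := dx1; apply; rewrite !inE ?zC ?yC //.
have yx : y != x by apply: contraTneq exy => ->; rewrite ie.
have [||||D DC cD] := IH (C :\ x) y.
- by move: Cm; rewrite (cardsD1 x C) xC.
- by rewrite !inE yx.
- have := dz y yC yx; rewrite /deg (cardsD1 x) !inE xC se exy ltnS.
  move/leq_trans; apply; apply/subset_leq_card/subsetP => z.
  by rewrite !inE => /and3P[-> -> ->].
- move=> z; rewrite !inE => /andP[zx zC] zy; apply: leq_trans (dz z zC zx) _.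
  apply/subset_leq_card/subsetP => t; rewrite !inE => /andP[tC ezt]; rewrite tC ezt !andbT.
  by apply: contraNneq zy => tx; apply/eqP/Nx; rewrite // -tx se.
by exists D => //; apply: subset_trans DC (subsetDl _ _).
Qed.

(** * Subdivisions in dense graphs *)

(** For a simple graph this is twice the number of edges induced on [W]. *)
Definition vol (T : finType) (e : rel T) (W : {set T}) : nat :=
  \sum_(v in W) deg e W v.

Definition restrict (T : finType) (e : rel T) (U : {set T}) : rel T :=
  fun a b => [&& a \in U, b \in U & e a b].

Definition connected (T : finType) (e : rel T) (U : {set T}) : bool :=
  [forall a in U, forall b in U, connect (restrict e U) a b].

Definition boundary (T : finType) (e : rel T) (W U : {set T}) : {set T} :=
  [set v in W :\: U | [exists u in U, e v u]].

Section Mader.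

Variables (T : finType) (e : rel T).
Hypothesis simple_e : simple_graph e.

Let se : symmetric e. Proof. by case: simple_e. Qed.
Let ie : irreflexive e. Proof. by case: simple_e. Qed.

Lemma degD1 (W : {set T}) u v : v \in W -> deg e W u = e u v + deg e (W :\ v) u.
Proof.
move=> vW; rewrite /deg (cardsD1 v) !inE vW /=; congr (_ + _).
by apply: eq_card => z; rewrite !inE andbA.
Qed.

Lemma deg_sum (W : {set T}) v : deg e W v = \sum_(u in W) e v u.
Proof.
rewrite /deg -sum1_card big_mkcond [RHS]big_mkcond; apply: eq_bigr => u _.
by rewrite !inE; case: (u \in W); case: (e v u).
Qed.

Lemma degS (W W' : {set T}) v : W \subset W' -> deg e W v <= deg e W' v.
Proof.
move=> /subsetP sW; apply/subset_leq_card/subsetP => u; rewrite !inE => /andP[/sW-> ->] //.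
Qed.

Lemma volD1 (W : {set T}) v : v \in W -> vol e W = vol e (W :\ v) + 2 * deg e W v.
Proof.
move=> vW; rewrite /vol (big_setD1 v) //=.
under eq_bigr => u _ do rewrite (degD1 u vW).
rewrite big_split /= (degD1 v vW) ie add0n [in RHS]deg_sum.
have -> : \sum_(u in W :\ v) e u v = \sum_(u in W :\ v) e v u.
  by apply: eq_bigr => u _; rewrite se.
by rewrite -deg_sum; lia.
Qed.

Lemma restrictS (U U' : {set T}) a b :
  U \subset U' -> connect (restrict e U) a b -> connect (restrict e U') a b.
Proof.
move=> /subsetP sU; apply: connect_sub => x y /and3P[xU yU exy].
by apply: connect1; rewrite /restrict !sU.
Qed.

Lemma restrict_sym (U : {set T}) : symmetric (restrict e U).
Proof. by move=> a b; rewrite /restrict se andbCA. Qed.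

Lemma connectedU1 (U : {set T}) v u :
  connected e U -> u \in U -> e v u -> connected e (v |: U).
Proof.
move=> /forall_inP cU uU evu.
have c z : z \in v |: U -> connect (restrict e (v |: U)) u z.
  rewrite !inE => /orP[/eqP->|zU].
    by apply: connect1; rewrite /restrict !inE uU eqxx orbT se.
  apply: (@restrictS U); first exact: subsetUr.
  by have /forall_inP := cU u uU; apply.
apply/forall_inP => a aU; apply/forall_inP => b bU.
apply: connect_trans (c b bU); rewrite (sym_connect_sym (@restrict_sym _)).
exact: c.
Qed.

(** Supplies the interior of a path through [U] that will stand in for a missing edge of $H$. *)
Lemma connected_path (U : {set T}) x y a b :
  connected e U -> a \in U -> b \in U -> e x a -> e b y ->
  exists s, [/\ path e x (rcons s y), uniq s & {subset s <= U}].
Proof.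
move=> /forall_inP/(_ a) + aU bU xa be; move=> /(_ aU)/forall_inP/(_ b bU)/connectP[p pp eb].
move: be bU; rewrite eb; case/shortenP: pp => p' pp' up' _ be _.
exists (a :: p'); split=> //.
  rewrite rcons_cons /= xa rcons_path be andbT.
  by apply: sub_path pp' => c d /and3P[].
move=> z; rewrite inE => /orP[/eqP->//|].
elim: p' a {xa aU eb up' be} pp' => //= c p' IH a /andP[/and3P[_ cU _] /IH{}IH].
by rewrite inE => /orP[/eqP->|/IH].
Qed.

(* [vol e (W :\: U) + 2 * #|boundary e W U|] is twice the number of edges of the graph obtained
   from [e] on [W] by contracting [U]. *)
Lemma dense_boundary d (W : {set T}) :
  0 < d -> 0 < #|W| -> 2 * d * #|W| <= vol e W ->
  exists U N : {set T}, U \subset W /\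
    [/\ connected e U, N != set0, N \subset W :\: U,
        forall v, v \in N -> exists2 u, u \in U & e v u &
        forall v, v \in N -> d <= deg e N v].
Proof.
move=> d0; have [m] := ubnP #|W|; elim: m W => // m IH W Wm W0 dW.
pose phi U := vol e (W :\: U) + 2 * #|boundary e W U|.
(* [U] may grow as long as the contracted graph keeps more than [d] edges per vertex outside [U]; a
   maximal such [U] is taken. *)
pose P (U : {set T}) := [&& U \subset W, U != set0, connected e U & 2 * d * #|W :\: U| < phi U].
have /card_gt0P[r rW] := W0.
have P0 : P [set r].
  rewrite /P sub1set rW /=; apply/and3P; split.
  - by apply/set0Pn; exists r; rewrite !inE.
  - by apply/forall_inP => a /set1P->; apply/forall_inP => b /set1P->; apply: connect0.
  - rewrite /phi; have -> : #|boundary e W [set r]| = deg e W r.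
      apply: eq_card => v; rewrite !inE; apply/idP/idP.
        by case/andP=> /andP[_ ->] /exists_inP[u /set1P->]; rewrite se.
      case/andP=> vW erv; rewrite vW andbT; apply/andP; split.
        by apply: contraTneq erv => ->; rewrite ie.
      by apply/exists_inP; exists r; rewrite ?inE // se.
    rewrite -(volD1 rW); apply: leq_trans dW.
    by rewrite ltn_pmul2l ?muln_gt0 // (cardsD1 r W) rW.
have [U /maxsetP[/and4P[UW U0 cU phiU] maxU] _] := maxset_exists P0.
have sUW : W :\: U \subset W by apply: subsetDl.
(* With an empty boundary, the part of [W] outside [U] is itself dense enough, and smaller. *)
have [N0|N0] := eqVneq (boundary e W U) set0.
  have /set0Pn[u uU] := U0.
  have volU : 2 * d * #|W :\: U| < vol e (W :\: U) by move: phiU; rewrite /phi N0 cards0 addn0.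
  have [|||U' [N [c0 [c1 c2 c3 c4 c5]]]] := IH (W :\: U).
  - rewrite -ltnS; apply: leq_trans Wm; rewrite ltnS; apply: proper_card; apply/properP; split=> //.
    by exists u; rewrite ?(subsetP UW) // !inE uU.
  - rewrite lt0n; apply: contraTneq volU => /eqP; rewrite cards_eq0 => /eqP->.
    by rewrite /vol big_set0.
  - exact: ltnW.
  exists U', N; split; [exact: subset_trans c0 sUW | split=> //; apply: subset_trans c3 _; exact: setSD].
exists U, (boundary e W U); split=> //; split=> //.
- by apply/subsetP => v; rewrite inE => /andP[].
- by move=> v; rewrite inE => /andP[_ /exists_inP].
move=> v vN; have := vN; rewrite inE => /andP[vWU /exists_inP[u uU evu]].
have vU : v \notin U by move: vWU; rewrite inE => /andP[].
have vW : v \in W by move: vWU; rewrite inE => /andP[].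
have WvU : W :\: (v |: U) = (W :\: U) :\ v.
  by apply/setP => z; rewrite !inE; case: (z == v).
(* Merging [v] into [U] removes one vertex, so by maximality it costs more than [d] edges: the one
   to [U] and one per neighbour of [v] in the boundary. Hence [v] has at least [d] neighbours
   there. *)
have nP : ~~ P (v |: U).
  apply: contra vU => PvU; rewrite -(maxU _ PvU (subsetUr _ _)) setU11 //.
rewrite leqNgt; apply: contra nP => dv; apply/and4P; split.
- by rewrite subUset sub1set vW.
- by apply/set0Pn; exists v; rewrite setU11.
- exact: connectedU1 evu.
have volU : vol e (W :\: U) = vol e (W :\: (v |: U)) + 2 * deg e (W :\: U) v.
  by rewrite WvU; apply: volD1.
have cW : #|W :\: U| = #|W :\: (v |: U)|.+1.
  by rewrite WvU (cardsD1 v (W :\: U)) vWU.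
have bd : #|boundary e W U| + deg e (W :\: U) v
     <= #|boundary e W (v |: U)| + 1 + deg e (boundary e W U) v.
  have e1 : #|boundary e W U| = 1 + #|boundary e W U :\ v| by rewrite (cardsD1 v) vN.
  pose A := [set w in W :\: U | e v w].
  have e2 : deg e (boundary e W U) v = #|A :&: boundary e W U|.
    by apply: eq_card => w; rewrite !inE -!andbA; do ![case: (_ \in _)] => //=; rewrite andbC.
  have e3 : deg e (W :\: U) v = #|A :&: boundary e W U| + #|A :\: boundary e W U|.
    by rewrite cardsID.
  have dj : [disjoint boundary e W U :\ v & A :\: boundary e W U].
    rewrite -setI_eq0; apply/eqP/setP => w; rewrite !in_setI !in_setD in_set0.
    by case: (w \in boundary _ _ _); rewrite ?andbF.
  have : #|(boundary e W U :\ v) :|: (A :\: boundary e W U)| <= #|boundary e W (v |: U)|.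
    apply/subset_leq_card/subsetP => w; rewrite in_setU => /orP[].
      rewrite in_setD1 inE => /andP[wv /andP[wWU /exists_inP[z zU ewz]]].
      rewrite inE WvU in_setD1 wv wWU; apply/exists_inP; exists z => //.
      by rewrite in_setU zU orbT.
    rewrite in_setD => /andP[_]; rewrite inE => /andP[wWU evw].
    rewrite inE WvU in_setD1 wWU andbT; apply/andP; split.
      by apply: contraTneq evw => ->; rewrite ie.
    by apply/exists_inP; exists v; rewrite ?setU11 // se.
  rewrite cardsU (_ : _ :&: _ = set0) ?cards0; last by apply/eqP; rewrite setI_eq0.
  by rewrite e1 e2 e3; clear; lia.
by move: phiU; rewrite /phi volU cW mulnS; move: (2 * d * _) bd dv; clear; lia.
Qed.

(** Only the edge [u v] of [h] need not be mapped to an edge. Subdividing it and placing the new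
    vertex on the first inner vertex of the path leaves a shorter path to reroute, from the new
    vertex to [v]. *)
Lemma reroute_edge (TH : finType) (eH : rel TH) s (U : finType) (h : rel U) (g : U -> T) u v
    (W : {set T}) :
  simple_graph eH -> subdivision eH h -> h u v -> injective g ->
  (forall a b, h a b -> ~~ (((a == u) && (b == v)) || ((a == v) && (b == u))) ->
     e (g a) (g b)) ->
  path e (g u) (rcons s (g v)) -> uniq s -> (forall a, g a \notin s) ->
  (forall a, g a \in W) -> {subset s <= W} ->
  exists (U' : finType) (h' : rel U') (g' : U' -> T),
    [/\ subdivision eH h', injective g', forall a b, h' a b -> e (g' a) (g' b) &
        forall a, g' a \in W].
Proof.
move=> sH; elim: s U h g u v => [|z s IH] U h g u v eh huv ig ge ps us gs gW sW.
  exists U, h, g; split=> // a b hab.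
  have euv : e (g u) (g v) by case/andP: ps.
  have [/orP[]/andP[/eqP-> /eqP->]|] := boolP (((a == u) && (b == v)) || ((a == v) && (b == u))).
  - by [].
  - by rewrite se.
  - exact: ge.
have [seh ieh] := simple_subdivision sH eh.
have uv : u != v by apply: contraTneq huv => ->; rewrite ieh.
move: ps us => /= /andP[euz ps] /andP[zs us].
pose g' o := if o is Some a then g a else z.
have gz a : g a != z by have := gs a; rewrite inE negb_or => /andP[].
apply: (IH _ (subdiv_rel h u v) g' None (Some v)) => //.
- exact: subdivision_subdiv_rel.
- by rewrite /= eqxx orbT.
- move=> [a|] [b|] //=; [by move/ig->| |].
  + by move/eqP; rewrite (negbTE (gz a)).
  + by move/esym/eqP; rewrite (negbTE (gz b)).
- move=> [a|] [b|] //=; rewrite ?(inj_eq (@Some_inj _)) ?andbF ?orbF ?andbT.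
  + by case/andP=> hab nuv _; apply: ge.
  + by case/orP=> /eqP->; rewrite ?eqxx.
  + by case/orP=> /eqP->; [rewrite se|rewrite eqxx].
- by move=> [a|] //=; have := gs a; rewrite inE negb_or => /andP[].
- by move=> [a|] //=; apply: sW; rewrite inE eqxx.
- by move=> t ts; apply: sW; rewrite inE ts orbT.
Qed.

(** A list presentation of the edges allows removing them one at a time by induction. *)
Definition edge_list_rel (TH : finType) (s : seq (TH * TH)) : rel TH :=
  fun a b => ((a, b) \in s) || ((b, a) \in s).

Lemma simple_edge_list_rel (TH : finType) (s : seq (TH * TH)) :
  all (fun p => p.1 != p.2) s -> simple_graph (edge_list_rel s).
Proof.
move=> /allP ds; split=> [a b|a]; first by rewrite /edge_list_rel orbC.
by rewrite /edge_list_rel orbb; apply/negP => /ds /=; rewrite eqxx.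
Qed.

(** One edge of $H$ is set aside, the rest is found in the set [N] given by [dense_boundary], and
    the edge is then routed through [U]. Passing to [N] halves the density, whence the power of
    two. *)
Lemma dense_contains_edge_list (TH : finType) (s : seq (TH * TH)) (W : {set T}) :
  all (fun p => p.1 != p.2) s -> 0 < #|W| -> 2 ^ size s * #|TH|.+1 * #|W| <= vol e W ->
  exists (U : finType) (h : rel U) (g : U -> T),
    [/\ subdivision (edge_list_rel s) h, injective g, forall a b, h a b -> e (g a) (g b) &
        forall a, g a \in W].
Proof.
elim: s W => [|[x y] s IH] W.
  move=> _ W0; rewrite mul1n => dW.
  (* With no edges left, only enough vertices are needed; a vertex of large degree provides them. *)
  have lW : #|TH| <= #|W|.
    have [v vW dv] : exists2 v, v \in W & #|TH| <= deg e W v.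
      apply/exists_inP; apply: contraLR dW => /exists_inPn H; rewrite -ltnNge.
      have : vol e W <= \sum_(v in W) #|TH|.
        by apply: leq_sum => v vW; rewrite ltnW // ltnNge H.
      by move/leq_ltn_trans; apply; rewrite sum_nat_const mulnC ltn_pmul2r.
    apply: leq_trans dv _; apply/subset_leq_card/subsetP => u.
    by rewrite inE => /andP[].
  pose g (a : TH) := enum_val (widen_ord lW (enum_rank a)).
  exists TH, (edge_list_rel [::]), g; split=> //.
  - exact/subdiv_base/graph_iso_refl.
  - by move=> a b /enum_val_inj/(congr1 val)/= /ord_inj/enum_rank_inj.
  - by move=> a; apply: enum_valP.
move=> /= /andP[/= xy ds] W0 dW.
have sH := simple_edge_list_rel ds.
(* The list may contain an edge twice, for instance in both orientations; then nothing has to be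
   added. *)
have [exy|nexy] := boolP (edge_list_rel s x y).
  have [U [h [g [g1 g2 g3 g4]]]] : exists (U : finType) (h : rel U) (g : U -> T),
    [/\ subdivision (edge_list_rel s) h, injective g, forall a b, h a b -> e (g a) (g b) &
        forall a, g a \in W].
    by apply: IH => //; apply: leq_trans dW; rewrite expnS -!mulnA leq_pmull.
  exists U, h, g; split=> //; apply: subdivision_eq g1 => a b.
  rewrite /edge_list_rel !inE !xpair_eqE; apply/idP/idP.
    by case/orP=> ->; rewrite !orbT.
  case/orP=> /orP[/andP[/eqP-> /eqP->]|->]; rewrite ?orbT //.
  by rewrite orbC.
have nexy' : ~~ edge_list_rel s y x by rewrite /edge_list_rel orbC.
have [|||U0 [N [UW [cU N0 /subsetP NW NU dN]]]] := @dense_boundary (2 ^ size s * #|TH|.+1) W.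
- by rewrite muln_gt0 expn_gt0.
- by [].
- by rewrite mulnA -expnS.
have [||U [h [g [g1 g2 g3 g4]]]] := IH N ds.
- by rewrite card_gt0.
- by rewrite mulnC -sum_nat_const; apply: leq_sum.
have [u [v [uv huv hvu hadd]]] := subdivision_add_edge g1 xy nexy nexy'.
(* Both ends have neighbours in the connected set [U], which is disjoint from [N] and so from the
   image of [g]. *)
have [a aU ea] := NU _ (g4 u).
have [b bU eb] := NU _ (g4 v).
rewrite se in eb.
have [q [pq uq qU]] := connected_path cU aU bU ea eb.
have sadd : simple_graph (edge_list_rel ((x, y) :: s)).
  by apply: simple_edge_list_rel; rewrite /= xy.
have Eadd : add_edge (edge_list_rel s) x y =2 edge_list_rel ((x, y) :: s).
  move=> c d; rewrite /add_edge /edge_list_rel !inE !xpair_eqE [(d == x) && _]andbC.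
  case: (c == x); case: (d == y); case: (c == y); case: (d == x);
  by case: ((c, d) \in s); case: ((d, c) \in s).
have huv' : add_edge h u v u v by rewrite /add_edge !eqxx orbT.
apply: (reroute_edge sadd (subdivision_eq Eadd hadd) huv' g2 _ pq uq).
- by move=> c d /orP[/g3|/orP[]->] //; rewrite ?orbT.
- by move=> c; apply/negP => /qU gU; have := NW _ (g4 c); rewrite inE gU.
- by move=> c; have := NW _ (g4 c); rewrite inE => /andP[].
- by move=> c /qU; apply: (subsetP UW).
Qed.

End Mader.

Lemma dense_contains_subdivision (TH : finType) (eH : rel TH) :
  simple_graph eH -> exists2 D, 0 < D &
  forall (T : finType) (e : rel T) (W : {set T}),
    simple_graph e -> 0 < #|W| -> D * #|W| <= vol e W ->
    exists (U : finType) (h : rel U) (g : U -> T),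
      [/\ subdivision eH h, injective g, forall a b, h a b -> e (g a) (g b) &
          forall a, g a \in W].
Proof.
move=> [sH iH]; pose s := [seq p <- enum {: TH * TH} | eH p.1 p.2].
have Es : edge_list_rel s =2 eH.
  have in_s a b : ((a, b) \in s) = eH a b by rewrite mem_filter mem_enum andbT.
  by move=> a b; rewrite /edge_list_rel !in_s (sH b) orbb.
exists (2 ^ size s * #|TH|.+1) => [|T e W se W0 dW]; first by rewrite muln_gt0 expn_gt0.
have ds : all (fun p : TH * TH => p.1 != p.2) s.
  apply/allP => -[a b]; rewrite mem_filter /= => /andP[eab _].
  by apply: contraTneq eab => ->; rewrite iH.
have [U [h [g [g1 g2 g3 g4]]]] := dense_contains_edge_list se ds W0 dW.
by exists U, h, g; split=> //; apply: subdivision_eq g1.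
Qed.

(** * Barycentric subdivision: from subgraphs to induced subgraphs *)

Definition is_edge (T : finType) (e : rel T) (S : {set T}) : bool :=
  [exists x, exists y, e x y && (S == [set x; y])].

(** Edges are taken as sets of two vertices, so that both orientations give the same subdividing
    vertex. *)
Definition barycentric_vertex (T : finType) (e : rel T) : finType :=
  (T + {S : {set T} | is_edge e S})%type.

Definition incidence (T : finType) (e : rel T) : rel (barycentric_vertex e) :=
  fun a b => match a, b with
    | inl x, inr E | inr E, inl x => x \in val E
    | _, _ => false
    end.

Section Barycentric.

Variables (T : finType) (e : rel T).
Hypothesis simple_e : simple_graph e.

Let se : symmetric e. Proof. by case: simple_e. Qed.
Let ie : irreflexive e. Proof. by case: simple_e. Qed.

Local Notation V := (barycentric_vertex e).

Definition within (W : {set T}) (a : V) : bool :=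
  match a with inl x => x \in W | inr E => val E \subset W end.

Lemma simple_incidence : simple_graph (@incidence T e).
Proof. by split=> [[x|S] [y|S']|[x|S]]. Qed.

Lemma card_barycentric_vertex : #|V| <= #|T| + vol e setT.
Proof.
rewrite card_sum leq_add2l card_sig.
pose k (p : T * T) := [set p.1; p.2].
have -> : vol e setT = #|[set p : T * T | e p.1 p.2]|.
  rewrite /vol (eq_bigl (fun=> true)) => [|v]; last by rewrite inE.
  under eq_bigr => v _ do rewrite deg_sum.
  rewrite pair_big_dep -sum1_card [RHS]big_mkcond /=.
  rewrite (eq_bigl (fun=> true)) => [|p]; last by rewrite !inE.
  by apply: eq_bigr => p _; rewrite inE; case: (e _ _).
apply: leq_trans (leq_imset_card k _); apply/subset_leq_card/subsetP => S.
rewrite inE => /existsP[x /existsP[y /andP[exy /eqP->]]].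
by apply/imsetP; exists (x, y); rewrite ?inE.
Qed.

(* An edge of [h] is pending when its ends are mapped to the ends of an edge of [e] that has not
   been subdivided yet; each pending edge is subdivided in turn. *)
Lemma subdivide_pending_edges (TH : finType) (eH : rel TH) (W : {set T}) m
    (U : finType) (h : rel U) (g : U -> V) :
  #|[set p : U * U | h p.1 p.2 && ~~ incidence (g p.1) (g p.2)]| < m ->
  simple_graph eH -> subdivision eH h -> injective g -> (forall a, within W (g a)) ->
  (forall a b, incidence (g a) (g b) -> h a b) ->
  (forall a b, h a b -> ~~ incidence (g a) (g b) ->
     exists x y, [/\ g a = inl x, g b = inl y, e x y &
       forall c S, g c = inr S -> val S != [set x; y]]) ->
  exists A : {set V}, induced_subdiv eH (@incidence T e) A /\ forall a, a \in A -> within W a.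
Proof.
move=> + sH; elim: m U h g => // m IH U h g hm eh ig gW gi pend.
have [P0|[[a b] abP]] := set_0Vmem [set p : U * U | h p.1 p.2 && ~~ incidence (g p.1) (g p.2)].
  exists (g @: setT); split; last by move=> _ /imsetP[a _ ->].
  exists U, h, g; split=> //; split=> //; split=> // a b.
  apply/idP/idP => [|hab]; first exact: gi.
  by have := in_set0 (a, b); rewrite -P0 inE /= hab => /negbFE.
have := abP; rewrite inE /= => /andP[hab nab].
have [x [y [gax gby exy newS]]] := pend a b hab nab.
have edge_xy : is_edge e [set x; y] by apply/existsP; exists x; apply/existsP; exists y; rewrite exy /=.
pose z : V := inr (exist _ [set x; y] edge_xy).
have gz c : g c != z by apply/eqP => gc; have := newS _ _ gc; rewrite /= eqxx.
have [seh ieh] := simple_subdivision sH eh.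
have inz c : incidence z (g c) = (c == a) || (c == b).
  rewrite -(inj_eq ig c a) -(inj_eq ig c b) gax gby /z.
  by case: (g c) => [t|S] //=; rewrite !inE.
have inz' c : incidence (g c) z = (c == a) || (c == b) by rewrite -inz; case: simple_incidence.
pose g' o := if o is Some c then g c else z.
apply: (IH _ (subdiv_rel h a b) g').
(* No pair containing the new vertex is pending, so the pending pairs come from old ones other than
   [(a, b)]. *)
- apply: (@leq_ltn_trans #|[set p : U * U | h p.1 p.2 && ~~ incidence (g p.1) (g p.2)] :\ (a, b)|).
    pose k (p : U * U) := (Some p.1, Some p.2).
    have ik : injective k by case=> [c d] [c' d'] [-> ->].
    rewrite -(card_imset _ ik); apply/subset_leq_card/subsetP => -[[c|] [d|]]; rewrite !inE /=.
    + case/andP=> /andP[hcd ncd] icd; apply/imsetP; exists (c, d) => //.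
      rewrite !inE /= hcd icd !andbT xpair_eqE.
      by apply: contra ncd => ->.
    + by rewrite inz' andbN.
    + by have := inz d; rewrite /= => ->; rewrite andbN.
    + by [].
  by rewrite -ltnS; move: hm; rewrite (cardsD1 (a, b)) abP.
- exact: subdivision_subdiv_rel.
- move=> [c|] [d|] //=; [by move/ig->| |].
  + by move/eqP; rewrite (negbTE (gz c)).
  + by move/esym/eqP; rewrite (negbTE (gz d)).
- move=> [c|] //=; have := gW a; have := gW b; rewrite gax gby /= => yW xW.
  by apply/subsetP => t; rewrite !inE => /orP[]/eqP->.
- move=> [c|] [d|]; rewrite /g' ?inz ?inz' // => icd.
  rewrite /= gi //=; apply/negP => /orP[]/andP[/eqP E1 /eqP E2]; move: icd; rewrite E1 E2.
    by rewrite (negbTE nab).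
  by case: simple_incidence => -> _; rewrite (negbTE nab).
- move=> [c|] [d|]; rewrite /g' ?inz ?inz' /=; try by [|move=> ->].
  (* A pending edge over the same pair [[set x; y]] would, by injectivity of [g], be the edge just
     subdivided. *)
  case/andP=> hcd ncd icd; have [x' [y' [gc gd exy' new']]] := pend c d hcd icd.
  exists x', y'; split=> // -[c'|] S; first exact: new'.
  move=> [<-] /=; apply: contra ncd => /eqP E.
  have : x' \in [set x; y] by rewrite E !inE eqxx.
  have : y' \in [set x; y] by rewrite E !inE eqxx orbT.
  rewrite -(inj_eq ig c) -(inj_eq ig d) -(inj_eq ig c b) -(inj_eq ig d a) gc gd gax gby !inE.
  have x'y' : x' != y' by apply: contraTneq exy' => ->; rewrite ie.
  move=> /orP[]/eqP E1 /orP[]/eqP E2; rewrite E1 E2 ?eqxx ?orbT //; rewrite E1 E2 eqxx in x'y'; done.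
Qed.

(** Original vertices are pairwise nonadjacent after subdividing, so an edge outside the subgraph
    leaves no trace once its subdividing vertex is omitted. At the start every edge of [h] is
    pending. *)
Lemma induced_subdiv_of_subgraph (TH : finType) (eH : rel TH) (W : {set T})
    (U : finType) (h : rel U) (g : U -> T) :
  simple_graph eH -> subdivision eH h -> injective g ->
  (forall a b, h a b -> e (g a) (g b)) -> (forall a, g a \in W) ->
  exists A : {set V}, induced_subdiv eH (@incidence T e) A /\ forall a, a \in A -> within W a.
Proof.
move=> sH eh ig ge gW.
apply: (@subdivide_pending_edges TH eH W _ U h (fun a => inl (g a)) (ltnSn _)) => //.
  by move=> a b [/ig].
by move=> a b hab _; exists (g a), (g b); split=> //; apply: ge.
Qed.

(** A subdividing vertex has just two neighbours, so a core containing it contains both its ends;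
    the original vertices of the core then form a core of [e]. *)
Lemma two_core_of_barycentric (C : {set V}) :
  two_core (@incidence T e) C -> exists2 D : {set T}, two_core e D & #|D| <= #|C|.
Proof.
move=> [C0 C2]; pose D := [set x | inl x \in C].
have CS (S : {S : {set T} | is_edge e S}) x : inr S \in C -> x \in val S -> x \in D.
  move=> SC xS; have := C2 _ SC; rewrite inE.
  have /existsP[u /existsP[v /andP[euv /eqP ES]]] := valP S.
  apply: contraTT => xC; rewrite -leqNgt.
  have [w Sw] : exists w, forall y, y \in val S -> y != x -> y = w.
    move: xS; rewrite ES !inE => /orP[]/eqP->; [exists v|exists u] => y;
    by rewrite !inE => /orP[]/eqP->; rewrite ?eqxx.
  rewrite -(cards1 (inl w : V)); apply/subset_leq_card/subsetP => -[y|S'] //.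
    rewrite !inE /= => /andP[yC yS]; apply/eqP; congr inl; apply: Sw => //.
    by apply: contraNneq xC => <-.
  by rewrite !inE andbF.
exists D.
  split.
    have /set0Pn[[x|S] xC] := C0; first by apply/set0Pn; exists x; rewrite inE.
    have /existsP[u /existsP[v /andP[euv /eqP ES]]] := valP S.
    by apply/set0Pn; exists u; apply: (CS S) => //; rewrite ES !inE eqxx.
  move=> x; rewrite inE => xC; apply: leq_trans (C2 _ xC) _.
  (* [k] maps a neighbour [y] of [x] to the vertex subdividing the edge [x y]; the default [inl x]
     arises only for pairs that are no edge. *)
  pose k y : V := if insub [set x; y] is Some E then inr E else inl x.
  apply: leq_trans (leq_imset_card k _); apply/subset_leq_card/subsetP => -[y|S].
    by rewrite !inE andbF.
  rewrite inE => /andP[SC xS]; have {}xS : x \in val S by [].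
  have [y ES exy] : exists2 y, val S = [set x; y] & e x y.
    have /existsP[u /existsP[v /andP[euv /eqP ES]]] := valP S.
    move: xS; rewrite ES !inE => /orP[]/eqP->; first by exists v.
    by exists u; rewrite 1?setUC // se.
  apply/imsetP; exists y.
    by rewrite in_set exy andbT; apply: (CS S) => //; rewrite ES !inE eqxx orbT.
  by rewrite /k -ES valK.
have il : injective (inl : T -> V) by move=> ? ? [].
rewrite -(card_imset _ il); apply/subset_leq_card/subsetP => _ /imsetP[x + ->].
by rewrite inE.
Qed.

End Barycentric.

(** * Sparse graphs of large degree *)

Fixpoint ball (T : finType) (e : rel T) (x : T) n : {set T} :=
  if n is m.+1 then ball e x m :|: \bigcup_(y in ball e x m) [set z | e y z] else [set x].

Section Sparse.

Lemma ball_homo (T : finType) (e : rel T) (x : T) m n :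
  m <= n -> ball e x m \subset ball e x n.
Proof.
elim: n => [|n IH]; first by rewrite leqn0 => /eqP->.
rewrite leq_eqVlt => /orP[/eqP->//|]; rewrite ltnS => /IH/subset_trans; apply.
exact: subsetUl.
Qed.

Lemma path_ball (T : finType) (e : rel T) (x : T) p :
  path e x p -> last x p \in ball e x (size p).
Proof.
elim/last_ind: p => [|p z IH] /=; first by rewrite inE.
rewrite rcons_path last_rcons size_rcons => /andP[/IH pB ez].
by rewrite /= inE; apply/orP; right; apply/bigcupP; exists (last x p); rewrite ?inE.
Qed.

Lemma card_ball (T : finType) (e : rel T) (x : T) Delta n :
  (forall v, deg e setT v <= Delta) -> #|ball e x n| <= Delta.+1 ^ n.
Proof.
move=> dD; elim: n => [|n IH] /=; first by rewrite cards1.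
apply: leq_trans (leq_card_setU _ _) _.
have : #|\bigcup_(y in ball e x n) [set z | e y z]| <= \sum_(y in ball e x n) Delta.
  apply: (big_ind2 (fun (A : {set T}) m => #|A| <= m)); first by rewrite cards0.
    move=> A m A' m' Am Am'; apply: leq_trans (leq_card_setU _ _) _; exact: leq_add.
  move=> y _; apply: leq_trans (dD y); apply/subset_leq_card/subsetP => z.
  by rewrite !inE.
rewrite sum_nat_const expnS; move: IH; set b := #|ball e x n|; move=> IH.
set c := #|_|; set q := _ ^ n in IH *; nia.
Qed.

Variables (T : finType) (Delta g : nat).

Definition sparse (e : rel T) : Prop :=
  [/\ simple_graph e, forall v, deg e setT v <= Delta &
      forall C, two_core e C -> g <= #|C|].

(** Let a new core [C] use the edge [x y]. If [x] reaches [y] inside [C] by old edges, a core with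
    fewer than [g] vertices would put [y] in the ball. Otherwise, in the old component of [x] within
    [C], only [x] lost a neighbour, and [two_core_pendant] yields an old core. *)
Lemma sparse_add_edge (e : rel T) x y :
  0 < g -> sparse e -> deg e setT x < Delta -> deg e setT y < Delta -> y \notin ball e x g ->
  sparse (add_edge e x y) /\ vol e setT < vol (add_edge e x y) setT.
Proof.
move=> g0 [[se ie] dD gC] dx dy yB.
have xy : x != y.
  apply: contraNneq yB => <-; apply: (subsetP (ball_homo e x (leq0n g))).
  by rewrite inE.
have nexy : ~~ e x y.
  apply: contra yB => exy; apply: (subsetP (ball_homo e x g0)).
  have := @path_ball _ e x [:: y]; rewrite /= exy; exact.
have sadd : simple_graph (add_edge e x y).
  split=> [a b|a]; rewrite /add_edge ?ie /=.
    by rewrite se [(b == x) && _]andbC [(b == y) && _]andbC [in RHS]orbCA [in RHS]orbC orbA.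
  by apply/negP => /orP[]/andP[/eqP-> E]; rewrite ?(negbTE xy) // eq_sym (negbTE xy) in E.
have degx : deg (add_edge e x y) setT x = (deg e setT x).+1.
  rewrite /deg (_ : [set u in setT | add_edge e x y x u] = y |: [set u in setT | e x u]).
    by rewrite cardsU1 !inE (negbTE nexy).
  by apply/setP => u; rewrite !inE /add_edge eqxx (negbTE xy) /= orbF orbC.
have degy : deg (add_edge e x y) setT y = (deg e setT y).+1.
  rewrite /deg (_ : [set u in setT | add_edge e x y y u] = x |: [set u in setT | e y u]).
    by rewrite cardsU1 !inE se (negbTE nexy).
  by apply/setP => u; rewrite !inE /add_edge eqxx eq_sym (negbTE xy) /= orbC.
have addz z u : z != x -> z != y -> add_edge e x y z u = e z u.
  by move=> /negbTE zx /negbTE zy; rewrite /add_edge zx zy orbF.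
split; last first.
  rewrite /vol (bigD1 x) //= [X in _ < X](bigD1 x) //= degx addSn ltnS leq_add2l.
  apply: leq_sum => v _; apply/subset_leq_card/subsetP => u.
  by rewrite !inE /add_edge /= => ->.
split=> // [v|C [C0 C2]].
  have [->|vx] := eqVneq v x; first by rewrite degx.
  have [->|vy] := eqVneq v y; first by rewrite degy.
  by apply: leq_trans (dD v); apply/subset_leq_card/subsetP => u; rewrite !inE addz.
have [/andP[xC yC]|nC] := boolP ((x \in C) && (y \in C)); last first.
  apply: gC; split=> // z zC; apply: leq_trans (C2 z zC) _.
  apply/subset_leq_card/subsetP => u; rewrite !inE /add_edge => /andP[uC]; rewrite uC.
  case/orP=> [->//|/orP[]/andP[/eqP E1 /eqP E2]]; case/negP: nC; rewrite -E1 -E2 ?uC ?zC //.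
pose K := [set z in C | connect (restrict e C) x z].
have xK : x \in K by rewrite inE xC connect0.
have KC : K \subset C by apply/subsetP => z; rewrite inE => /andP[].
have closed_K z u : z \in K -> u \in C -> e z u -> u \in K.
  rewrite !inE => /andP[zC cz] uC ezu; rewrite uC; apply: connect_trans cz (connect1 _).
  by rewrite /restrict zC uC.
have [yK|yK] := boolP (y \in K).
  have := yK; rewrite inE => /andP[_ /connectP[p pp ey]].
  rewrite leqNgt; apply: contra yB => Cg; move: ey; case/shortenP: pp => p' pp' up' _ ey.
  have pe : path e x p' by apply: sub_path pp' => c d /and3P[].
  rewrite ey; apply: subsetP (path_ball pe); apply: ball_homo.
  apply: leq_trans (ltnW Cg); apply: ltnW.
  have -> : (size p').+1 = #|x :: p'| by apply/esym/card_uniqP.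
  apply/subset_leq_card/subsetP => z; rewrite inE => /orP[/eqP->//|].
  elim: (p') (x) pp' {up' ey pe} => //= c q IH w /andP[/and3P[_ cC _] /IH{}IH].
  by rewrite inE => /orP[/eqP->|/IH].
have [|||D DK cD] := @two_core_pendant T e K x _ xK.
- by [].
- have := C2 x xC; rewrite /deg (cardsD1 y) !inE yC {1}/add_edge !eqxx orbT ltnS.
  move/leq_trans; apply; apply/subset_leq_card/subsetP => z; rewrite !inE /add_edge.
  rewrite eqxx (negbTE xy) /= orbF => /and3P[zy zC /orP[exz|/eqP E]]; last by rewrite E eqxx in zy.
  by have := closed_K x z xK zC exz; rewrite inE exz => ->.
- move=> z zK zx; have zC := subsetP KC z zK; apply: leq_trans (C2 z zC) _.
  apply/subset_leq_card/subsetP => u; rewrite inE => /andP[uC].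
  rewrite addz // => [ezu|]; last by apply: contraNneq yK => <-.
  by rewrite inE ezu andbT; apply: closed_K ezu.
exact: leq_trans (gC D cD) (subset_leq_card (subset_trans DK KC)).
Qed.

Lemma vol_max (e : rel T) : (forall v, deg e setT v <= Delta) -> vol e setT <= Delta * #|T|.
Proof.
move=> dD; rewrite mulnC -cardsT -sum_nat_const; exact: leq_sum.
Qed.

(* While the deficient vertices are too many to lie in one ball of radius [g], two of
   them can be joined. *)
Lemma exists_sparse_dense :
  0 < g -> exists2 e : rel T, sparse e & Delta * (#|T| - Delta.+1 ^ g) <= vol e setT.
Proof.
move=> g0.
(* The recursion is on the room left below the maximal value of [vol], which every added edge
   reduces. *)
have step m (e : rel T) : sparse e -> Delta * #|T| - vol e setT < m ->
    exists2 e : rel T, sparse e & Delta * (#|T| - Delta.+1 ^ g) <= vol e setT.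
  elim: m e => // m IH e sp lm; have [_ dD _] := sp.
  pose L := [set v | deg e setT v < Delta].
  (* If few vertices are deficient, the others, all of degree [Delta], already give the required
     volume. *)
  have [Lle|Lgt] := leqP #|L| (Delta.+1 ^ g).
    exists e => //; apply: (@leq_trans (Delta * #|~: L|)).
      by rewrite cardsCs setCK leq_mul2l leq_sub2l ?orbT.
    rewrite mulnC -sum_nat_const /vol big_mkcond [X in _ <= X]big_mkcond /=.
    by apply: leq_sum => v _; rewrite !inE -leqNgt; case: ifP.
  have /card_gt0P[x xL] : 0 < #|L| by apply: leq_ltn_trans Lgt.
  have /subsetPn[y yL yB] : ~~ (L \subset ball e x g).
    apply: contraTN Lgt => /subset_leq_card LB; rewrite -leqNgt.
    exact: leq_trans LB (card_ball _ _ dD).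
  rewrite !inE in xL yL.
  have [sp' lt] := sparse_add_edge g0 sp xL yL yB.
  apply: (IH _ sp'); have [_ dD' _] := sp'; have := vol_max dD'.
  by move: lm lt; set a := _ * _; lia.
apply: (step _ (fun _ _ => false) _ (ltnSn _)); split=> // [v|C [/set0Pn[x xC] /(_ x xC)]].
  by rewrite /deg (_ : [set u in _ | _] = set0) ?cards0 //; apply/setP => u; rewrite !inE.
by rewrite /deg (_ : [set u in _ | _] = set0) ?cards0 //; apply/setP => u; rewrite !inE andbF.
Qed.

End Sparse.

(** * Graphs with large hitting sets and few disjoint induced subdivisions *)

Lemma vol_setC (T : finType) (e : rel T) Delta (X : {set T}) :
  simple_graph e -> (forall v, deg e setT v <= Delta) ->
  vol e setT <= vol e (~: X) + 2 * Delta * #|X|.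
Proof.
move=> se dD; have [m] := ubnP #|X|; elim: m X => // m IH X Xm.
have [->|/set0Pn[x xX]] := eqVneq X set0; first by rewrite setC0 leq_addr.
have cX : #|X| = #|X :\ x|.+1 by rewrite (cardsD1 x) xX.
have := IH (X :\ x); rewrite -ltnS -cX => /(_ Xm).
have xC : x \in ~: (X :\ x) by rewrite !inE eqxx.
have := volD1 se xC; have -> : ~: (X :\ x) :\ x = ~: X.
  by apply/setP => z; rewrite !inE; have [->|] := eqVneq z x; rewrite ?xX.
have : deg e (~: (X :\ x)) x <= Delta by apply: leq_trans (dD x); apply: degS; apply: subsetT.
by rewrite cX mulnS => ? ->; lia.
Qed.

Lemma induced_subdiv_two_core (TH T : finType) (eH : rel TH) (e : rel T) (A : {set T}) :
  simple_graph eH -> has_cycle eH -> induced_subdiv eH e A ->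
  exists2 C : {set T}, two_core e C & C \subset A.
Proof.
move=> sH cH [U [h [g [eh [ig [<- ge]]]]]].
have [C cC] := two_core_subdivision sH (two_core_of_cycle (proj1 sH) cH) eh.
exists (g @: C); first by apply: two_core_emb cC => // a b; rewrite ge.
exact/imsetS/subsetT.
Qed.

Lemma erdos_posa_gap (TH : finType) (eH : rel TH) :
  simple_graph eH -> has_cycle eH -> exists2 Delta, 0 < Delta & forall g, 0 < g ->
  exists (T : finType) (e : rel T), [/\ simple_graph e,
    forall X, hits_all eH e X -> Delta.+1 ^ g < 4 * #|X| &
    forall P : {set {set T}}, (forall A, A \in P -> induced_subdiv eH e A) -> trivIset P ->
      #|P| * g <= 2 * Delta.+1 ^ g.+1].
Proof.
move=> sH cH; have [D D0 dense] := dense_contains_subdivision sH.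
exists (4 * D) => [|g g0]; first by rewrite muln_gt0.
set N := (4 * D).+1 ^ g; have N0 : 0 < N by rewrite expn_gt0.
have [e [se dD gC] vole] := exists_sparse_dense 'I_(2 * N) (4 * D) g0.
rewrite card_ord -/N in vole.
exists (barycentric_vertex e), (@incidence _ e); split.
- exact: simple_incidence.
- move=> X hX; rewrite ltnNge; apply/negP => XN.
  have x0 : 'I_(2 * N) by exists 0; rewrite muln_gt0.
  (* Each subdividing vertex of [X] is traded for one of its ends, giving a set [Y] of original
     vertices that is no larger. The default [x0] is never taken, as edges are nonempty. *)
  pose rep (v : barycentric_vertex e) :=
    match v with inl x => x | inr E => odflt x0 [pick x in val E] end.
  pose Y := rep @: X.
  have YX : #|Y| <= #|X| by apply: leq_imset_card.
  have cY := cardsC Y; rewrite card_ord in cY.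
  have [|| U [h [i [eh ii he iW]]]] := dense _ e (~: Y) se.
  + by move: cY YX XN N0; clear; lia.
  (* The volume is at least [4 * D * N]; removing at most [N / 4] vertices costs at most
     [2 * D * N], and what remains suffices for at most [2 * N] vertices. *)
  + have := vol_setC Y se dD; have z2N : #|~: Y| <= 2 * N by rewrite -[X in _ <= X]card_ord max_card.
    have y4N : 4 * #|Y| <= N by apply: leq_trans XN; rewrite leq_mul2l.
    have := leq_mul (leqnn D) z2N; have := leq_mul (leqnn D) y4N.
    by move: vole; clear; nia.
  (* The copy found lies over the complement of [Y]; a vertex of it in [X] would have its
     representative in [Y]. *)
  have [A [iA AW]] := induced_subdiv_of_subgraph se sH eh ii he iW.
  have /pred0Pn[a /andP[/= aA aX]] := hX A iA.
  have aY : rep a \in Y by apply: imset_f.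
  have := AW a aA; case: a aX aA aY => [x|E] aX aA aY /=; first by rewrite inE aY.
  move/subsetP/(_ (rep (inr E))); rewrite inE aY => H; apply: notF; apply: H.
  rewrite /rep; case: pickP => [x //|E0].
  have /existsP[u /existsP[v /andP[euv /eqP ES]]] := valP E.
  by have := E0 u; rewrite ES !inE eqxx.
move=> P iP tP; have sz A : A \in P -> g <= #|A|.
  move=> /iP iA; have [C cC CA] := induced_subdiv_two_core sH cH iA.
  have [C' cC' le] := two_core_of_barycentric se cC.
  exact: leq_trans (gC _ cC') (leq_trans le (subset_leq_card CA)).
(* The disjoint copies have at least [g] vertices each, and there are at most
   [2 * N + 4 * D * (2 * N)] vertices in all. *)
apply: (@leq_trans #|barycentric_vertex e|).
  rewrite -sum_nat_const; apply: (@leq_trans #|cover P|); last exact: max_card.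
  by rewrite -(eqP tP); apply: leq_sum.
apply: leq_trans (card_barycentric_vertex e) _.
rewrite expnS -/N; apply: leq_trans (leq_add (leqnn _) (vol_max dD)) _.
by rewrite card_ord; clear; nia.
Qed.

(** * The gap between tau and nu *)

Lemma ex_max_nat (Q : nat -> Prop) B :
  (exists n, Q n) -> (forall n, Q n -> n <= B) -> exists2 k, Q k & forall n, Q n -> n <= k.
Proof.
move=> Q0; elim: B => [|B IH] leB.
  by case: Q0 => n Qn; exists n => // m /leB; rewrite leqn0 => /eqP->.
have [QB|nQB] := classic (Q B.+1); first by exists B.+1.
apply: IH => n Qn; have := leB n Qn; rewrite leq_eqVlt => /orP[/eqP En|//].
by rewrite En in Qn.
Qed.

Lemma ex_min_nat (Q : nat -> Prop) :
  (exists n, Q n) -> exists2 k, Q k & forall n, Q n -> k <= n.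
Proof.
(* Minimising is maximising the distance below a known member [m]. *)
case=> m Qm; have [||k [Qk km] kmax] := @ex_max_nat (fun k => Q (m - k) /\ k <= m) m.
- by exists 0; rewrite subn0.
- by move=> n [].
exists (m - k) => // n Qn; have [nm|/ltnW mn] := leqP n m; last exact: leq_trans (leq_subr _ _) mn.
by have := kmax (m - n); rewrite subKn // leq_subr => /(_ (conj Qn isT)); lia.
Qed.

Lemma exists_nu (TH T : finType) (eH : rel TH) (e : rel T) : exists k, is_nu eH e k.
Proof.
have [||k Qk kmax] := @ex_max_nat (fun k => exists P : {set {set T}},
    (forall A, A \in P -> induced_subdiv eH e A) /\ trivIset P /\ #|P| = k) #|{set T}|.
- exists 0, set0; split=> [A|]; first by rewrite inE.
  split; last by rewrite cards0.
  by apply/trivIsetP => A B; rewrite inE.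
- by move=> n [P [_ [_ <-]]]; apply: max_card.
by exists k; split=> // P iP tP; apply: kmax; exists P.
Qed.

Lemma exists_tau (TH T : finType) (eH : rel TH) (e : rel T) :
  0 < #|TH| -> exists t, is_tau eH e t.
Proof.
move=> TH0; have [|t Qt tmin] := @ex_min_nat (fun t => exists X : {set T}, hits_all eH e X /\ #|X| = t).
  exists #|[set: T]|, setT; split=> // A [U [h [g [eh [_ [<- _]]]]]].
  have /card_gt0P[u _] := leq_trans TH0 (subdivision_card eh).
  by apply/pred0Pn; exists (g u); rewrite /= inE imset_f.
by exists t; split=> // X hX; apply: tmin; exists X.
Qed.

(** * Real estimates and the comparison with [f] *)

Local Open Scope R_scope.

(** The asymptotic hypothesis says nothing about small [k]; there a constant bound is beaten by a
    large [g]. *)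
Lemma bounded_initial (f : nat -> R) K : exists M, forall k, (k < K)%N -> f k <= M.
Proof.
elim: K => [|K [M HM]]; first by exists 0.
exists (Rmax M (f K)) => k; rewrite ltnS leq_eqVlt => /orP[/eqP->|/HM kM]; first exact: Rmax_r.
exact: Rle_trans kM (Rmax_l _ _).
Qed.

(** The crude bound [ln c <= c] is enough, since [c] will depend only on $H$. *)
Lemma ln_pow_le (c : R) n : 1 <= c -> ln (c ^ n) <= INR n * c.
Proof.
move=> c1; elim: n => [|n IH]; first by rewrite /= ln_1; lra.
rewrite -tech_pow_Rmult ln_mult; [|lra|by apply: pow_lt; lra].
have : ln c <= c.
  by apply: Rlt_le; apply: exp_lt_inv; rewrite exp_ln; [have := exp_ineq1 c; lra|lra].
by rewrite S_INR; lra.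
Qed.

Lemma INR_expn a n : INR (a ^ n)%N = INR a ^ n.
Proof. by elim: n => [|n IH] //; rewrite expnS mult_INR IH. Qed.

Lemma INR_leq m n : (m <= n)%N -> INR m <= INR n.
Proof. by move/leP/le_INR. Qed.

Lemma INR_ltn m n : (m < n)%N -> INR m < INR n.
Proof. by move/ltP/lt_INR. Qed.

Theorem mainTheorem9 (TH : finType) (eH : rel TH) :
  simple_graph eH -> has_cycle eH -> max_deg_le3 eH ->
  forall f : nat -> R, little_o_klogk f ->
  exists (T : finType) (e : rel T) (k t : nat),
    simple_graph e /\ is_nu eH e k /\ is_tau eH e t /\ Rlt (f k) (INR t).
Proof.
move=> sH cH _ f fo.
have TH0 : (0 < #|TH|)%N.
  by case: cH => -[|x s] [] // _ _; apply/card_gt0P; exists x.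
have [Delta Delta0 gap] := erdos_posa_gap sH cH.
pose c := INR Delta.+1.
have INR2 : INR 2 = 2 by rewrite /=; lra.
have INR4 : INR 4 = 4 by rewrite /=; lra.
have c2 : 2 <= c by have := INR_leq (Delta0 : (1 < Delta.+1)%N); rewrite INR2 -/c.
(* The constant is chosen so that the bound [6 * c * c * c ^ g] on [k ln k], proved below, becomes
   [c ^ g / 4], which is less than [t]. *)
have [K fK] := fo (/ (24 * c * c)) ltac:(apply: Rinv_0_lt_compat; nra).
have [M fM] := bounded_initial f K.+1.
have [g0 g0M] := INR_unbounded (4 * M).
pose g := g0.+1.
have [T [e [se htau hnu]]] := gap g isT.
have [k nuk] := exists_nu eH e.
have [t taut] := exists_tau eH e TH0.
exists T, e, k, t; split=> //; split=> //; split=> //.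
have [[X [hX Xt]] _] := taut.
have [[P [iP [tP Pk]]] _] := nuk.
have Nt : c ^ g < 4 * INR t.
  by have := INR_ltn (htau X hX); rewrite INR_expn mult_INR Xt -/c INR4.
have kg : INR k * INR g <= 2 * (c * c ^ g).
  by have := INR_leq (hnu P iP tP); rewrite (mult_INR 2) INR_expn mult_INR Pk INR2 -/c -tech_pow_Rmult.
(* For small [k], the choice of [g0] gives [f k <= M < g / 4 <= c ^ g / 4 < t]. *)
have [kK|Kk] := ltnP k K.+1.
  have gN : INR g <= c ^ g.
    rewrite -INR_expn; apply: INR_leq; apply: ltnW; apply: ltn_expl; by [].
  by have := fM k kK; move: gN; rewrite /g S_INR -/g => gN; move: g0M; lra.
have k1 : 1 <= INR k by apply: (INR_leq (leq_ltn_trans (leq0n K) Kk)).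
have g1 : 1 <= INR g by apply: (@INR_leq 1).
have N0 : 0 < c ^ g by apply: pow_lt; lra.
(* From [kg], [1 <= g] and [2 <= c] follows [k <= c ^ g.+2], and [g + 2 <= 3 * g]. *)
have lnk : ln (INR k) <= 3 * INR g * c.
  apply: (@Rle_trans _ (ln (c ^ g.+2))).
    have [lt|->] : INR k <= c ^ g.+2.
      rewrite (_ : c ^ g.+2 = c * (c * c ^ g)) //; have cN : 0 < c * c ^ g by nra.
      by nra.
      by apply/Rlt_le/ln_increasing; lra.
    exact: Rle_refl.
  apply: Rle_trans (ln_pow_le _ _) _; first by lra.
  by rewrite (S_INR g.+1) (S_INR g); nra.
have fk : f k <= / (24 * c * c) * INR k * ln (INR k).
  by apply: Rle_trans (Rle_abs _) (fK k (ltnW Kk)).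
apply: Rle_lt_trans fk _.
(* The factor [g] from the logarithm is absorbed by [kg]; this is where the logarithmic gap
   appears. *)
have kln : INR k * ln (INR k) <= 6 * c * c * c ^ g.
  apply: (@Rle_trans _ (INR k * (3 * INR g * c))).
    by apply: Rmult_le_compat_l => //; lra.
  by nra.
rewrite Rmult_assoc; apply: (@Rle_lt_trans _ (/ (24 * c * c) * (6 * c * c * c ^ g))).
  apply: Rmult_le_compat_l => //; apply/Rlt_le/Rinv_0_lt_compat; nra.
have -> : / (24 * c * c) * (6 * c * c * c ^ g) = c ^ g / 4 by field; lra.
by lra.
Qed.
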